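(* (Another extended Rogers type formula for $\psi_n^{(\mathbf a,\mathbf b)}(x,y|q)$.) Let $|q|<1$. It is asserted that $$\sum_{n=0}^\infty\sum_{m=0}^\infty\sum_{k=0}^\infty(-1)^{n+m}q^{\binom n2+\binom m2}\,\psi_{n+m+k}^{(\mathbf a,\mathbf b)}(x,y|q)\,\frac{t^n}{(q;q)_n}\,\frac{s^m}{(q;q)_m}\,\frac{\omega^k}{(q;q)_k}$$ $$=\frac{(yt,ys;q)_\infty}{(y\omega;q)_\infty}\sum_{j=0}^\infty\frac{(a_1,a_2,\dots,a_{r+1};q)_j}{(q,b_1,b_2,\dots,b_r;q)_j}\,(xt)^j\;{}_3\Phi_2\!\left[\begin{matrix}q^{-j},\,q/(yt),\,s/\omega\\ q/(y\omega),\,0\end{matrix};q;q\right]\qquad(|y\omega|<1).$$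
   Context: Notation: $(a;q)_0=1$, $(a;q)_n=\prod_{k=0}^{n-1}(1-aq^k)$, $(a;q)_\infty=\prod_{k=0}^\infty(1-aq^k)$, $(c_1,\dots,c_m;q)_n=(c_1;q)_n\cdots(c_m;q)_n$ (also for $n=\infty$), and $\left[{n\atop k}\right]_q=\frac{(q;q)_n}{(q;q)_k(q;q)_{n-k}}$ is the $q$-binomial coefficient. Basic hypergeometric series: ${}_3\Phi_2\!\left[\begin{matrix}\alpha_1,\alpha_2,\alpha_3\\ \beta_1,\beta_2\end{matrix};q;z\right]=\sum_{i\ge0}\frac{(\alpha_1,\alpha_2,\alpha_3;q)_i}{(\beta_1,\beta_2;q)_i}\frac{z^i}{(q;q)_i}$. With parameters $\mathbf a=(a_1,\dots,a_{r+1})$ and $\mathbf b=(b_1,\dots,b_r)$, the generalized Al-Salam-Carlitz $q$-polynomials $\psi_n$ are $$\psi_n^{(\mathbf a,\mathbf b)}(x,y|q)=\sum_{k=0}^n\left[{n\atop k}\right]_q\frac{(a_1,\dots,a_{r+1};q)_k}{(b_1,\dots,b_r;q)_k}\,(-1)^kq^{\binom{k+1}2-nk}\,x^ky^{n-k}.$$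
   Formalization: As |yω|<1 alone lets the left side diverge, the identity is stated if the series with ψ expanded converges absolutely, and for all a, b degree by degree in x (degree j when |yω|<|q|^j); q, y, t, ω nonzero and no vanishing denominators are assumed. *)

(* Defs.v *)
From HB Require Import structures.
From mathcomp Require Import all_boot all_order all_algebra.
From mathcomp Require Import all_classical all_reals all_analysis.
From mathcomp Require Import complex.

Set Implicit Arguments.
Unset Strict Implicit.
Unset Printing Implicit Defensive.

Import Order.TTheory GRing.Theory Num.Theory.
Import numFieldNormedType.Exports.

Local Open Scope classical_set_scope.
Local Open Scope ring_scope.

Section Series.
Variable K : numFieldType.

Definition has_sum (u : nat -> K) (l : K) : Prop := series u @ \oo --> l.

Definition sumoo (u : nat -> K) : K := limn (series u).

(* Iterated sum, with convergence required at each of the three levels. *)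
Definition has_sum3 (u : nat -> nat -> nat -> K) (l : K) : Prop :=
  exists (v : nat -> nat -> K) (w : nat -> K),
    [/\ forall n m, has_sum (u n m) (v n m),
        forall n, has_sum (v n) (w n) & has_sum w l].

(* Boundedness of the partial sums over the boxes [0, N)^4; as these exhaust
   nat^4, this is absolute summability of the family.  It is used for the triple
   series in psi_(n+m+k) after expanding psi.  Summability of the unexpanded
   triple series would not be enough: for b empty, a = [:: a0] and y = x one has
   psi_n = (a0 * x)^n, the triple series sums to
   (a0xt, a0xs; q)_oo / (a0xw; q)_oo, and the right-hand side may converge to a
   different value. *)
Definition abs_summable4 (u : nat -> nat -> nat -> nat -> K) : Prop :=
  exists M : K, forall N : nat,
    \sum_(n < N) \sum_(m < N) \sum_(k < N) \sum_(i < N) `|u n m k i| <= M.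

End Series.

Section QSeries.
Variable K : numFieldType.

Definition qpoch (a q : K) (n : nat) : K := \prod_(k < n) (1 - a * q ^+ k).

(* The limit exists whenever |q| < 1. *)
Definition qpochoo (a q : K) : K := limn (qpoch a q).

Definition qpochs (cs : seq K) (q : K) (n : nat) : K :=
  \prod_(c <- cs) qpoch c q n.

Definition qpochsoo (cs : seq K) (q : K) : K := \prod_(c <- cs) qpochoo c q.

(* Only meaningful for k <= n. *)
Definition qbinom (q : K) (n k : nat) : K :=
  qpoch q q n / (qpoch q q k * qpoch q q (n - k)).

(* Used only with al1 = q ^- j, for which all terms of index > j vanish. *)
Definition Phi32 (al1 al2 al3 be1 be2 q z : K) : K :=
  sumoo (fun i => qpochs [:: al1; al2; al3] q i / qpochs [:: be1; be2] q i
                  * (z ^+ i / qpoch q q i)).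

(* The monomial of degree k in x of psi_n.  The power of q has an integer
   (usually negative) exponent, so psi_n generically grows like q^-'C(n, 2): the
   triple series then diverges as a whole, whereas its part of degree k in x
   converges for |y * w| < |q|^k. *)
Definition psi_term (a b : seq K) (x y q : K) (n k : nat) : K :=
  if (k <= n)%N then
    qbinom q n k * (qpochs a q k / qpochs b q k) * (- 1) ^+ k
    * q ^ ('C(k.+1, 2)%:Z - (n * k)%:Z) * x ^+ k * y ^+ (n - k)
  else 0.

Definition psi (a b : seq K) (x y q : K) (n : nat) : K :=
  \sum_(k < n.+1) psi_term a b x y q n k.

Definition rogers_weight (q t s w : K) (n m k : nat) : K :=
  (- 1) ^+ (n + m) * q ^+ ('C(n, 2) + 'C(m, 2))
  * (t ^+ n / qpoch q q n) * (s ^+ m / qpoch q q m) * (w ^+ k / qpoch q q k).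

Definition rogers_prefactor (y q t s w : K) : K :=
  qpochsoo [:: y * t; y * s] q / qpochoo (y * w) q.

Definition rogers_rhs_term (a b : seq K) (x y q t s w : K) (j : nat) : K :=
  qpochs a q j / qpochs (q :: b) q j * (x * t) ^+ j
  * Phi32 (q ^- j) (q / (y * t)) (s / w) (q / (y * w)) 0 q q.

End QSeries.

(* Main.v *)
Require Import Defs.
From HB Require Import structures.
From mathcomp Require Import all_boot all_order all_algebra.
From mathcomp Require Import all_classical all_reals all_analysis.
From mathcomp Require Import complex ring zify.

(** Fix the degree [j] in [x]. As a function of [N = n + m + k], the term
    [psi_term _ _ _ _ _ N j] is, up to a factor independent of [N],
    [y ^+ N * \prod_(i < j) (q ^+ i / q ^+ N - 1)] (lemma [psi_termE]). This is
    what the operator [\prod_(i < j) (q ^+ i * eta - 1)] makes of the monomial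
    [y ^+ N], where [eta] is the dilation [y |-> y / q]. Hence the part of
    degree [j] of the triple series is, up to that factor, this operator applied
    to [\sum_(n, m, k) weight * y ^+ (n + m + k)], which factorizes; by Euler's
    two expansions ([has_sum_qpochoo], [has_sum_inv_qpochoo]) it equals
    [F y = (y t, y s; q)_oo / (y w; q)_oo]. The dilations of [y] that occur are
    by at most [q ^- j], so that all series involved converge for
    [`|y w| < `|q| ^+ j].

    The operator is computed on [F = f * g] with [f y = (y t; q)_oo] and
    [g y = (y s; q)_oo / (y w; q)_oo] by the q-analogue of Leibniz's rule. With
    [theta u y = (u (y / q) - u y) / y], the function [f] is an eigenfunction of
    [theta], while [theta] multiplies [g] by [(w - s) / q] and replaces [y w] by
    [y w / q]. The l-th Leibniz term thus contributes the product [dilated l],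
    and its coefficient is, up to powers of the parameters, the factor
    [(q^-j, s / w; q)_l / (q; q)_l] of the terminating 3-Phi-2; returning from
    [dilated l] to [F] gives the remaining factors
    [(q / (y t); q)_l / (q / (y w); q)_l]. In the proof the rule takes the form
    of a recursion in [j] ([q_factorS], [degree_sumS]), so that
    [has_sum3_degree] is an induction on [j] starting from Euler's expansions.

    For the full series, absolute summability is a severe condition: along
    [n = m = 0] the terms of degree [j] behave like [(y w / q ^+ j) ^+ k], so
    that a degree with a nonzero coefficient satisfies [`|y w| < `|q| ^+ j]
    ([abs_summable4_degree]). As [y w != 0], only finitely many degrees occur,
    and the full formula is a finite sum of the formulas for the single degrees;
    no exchange of infinite summations is involved. *)

Set Implicit Arguments.
Unset Strict Implicit.
Unset Printing Implicit Defensive.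

Import Order.TTheory GRing.Theory Num.Theory.
Import numFieldNormedType.Exports.

Local Open Scope classical_set_scope.
Local Open Scope ring_scope.

(** * Sums of sequences and of triple sequences *)

Section HasSum.
Variable K : numFieldType.
Implicit Types (u v : nat -> K) (z l : K).

Lemma has_sum_ext u v l : has_sum u l -> u =1 v -> has_sum v l.
Proof. by move=> ul /funext<-. Qed.

Lemma has_sum_unique u l l' : has_sum u l -> has_sum u l' -> l = l'.
Proof.
move=> ul ul'.
by rewrite -(cvg_lim (@norm_hausdorff _ _) ul) (cvg_lim _ ul').
Qed.

Lemma has_sumD u v l l' :
  has_sum u l -> has_sum v l' -> has_sum (fun n => u n + v n) (l + l').
Proof.
rewrite /has_sum => ul vl; have -> : (fun n => u n + v n) = u + v by [].
by rewrite seriesD; exact: cvgD.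
Qed.

Lemma has_sumZ c u l : has_sum u l -> has_sum (fun n => c * u n) (c * l).
Proof.
rewrite /has_sum => ul;
have -> : series (fun n => c * u n) = (fun n => c * series u n).
  by apply/funext => n; rewrite /series /= mulr_sumr.
exact: cvgMl_tmp.
Qed.
Arguments has_sumZ c {u l} _.

Lemma has_sumB u v l l' :
  has_sum u l -> has_sum v l' -> has_sum (fun n => u n - v n) (l - l').
Proof.
move=> ul vl; rewrite -[- l']mulN1r.
apply: (has_sum_ext (has_sumD ul (has_sumZ (-1) vl))) => n.
by rewrite mulN1r.
Qed.

Lemma has_sum_shift u l :
  u 0%N = 0 -> has_sum (fun n => u n.+1) l -> has_sum u l.
Proof.
move=> u0; rewrite /has_sum -[in X in _ -> X]cvg_shiftS.
suff -> : [sequence series u n.+1]_n = series (fun n => u n.+1) by [].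
by apply/funext => n; rewrite /series /= big_nat_recl//= u0 add0r.
Qed.

Lemma has_sum_finite u N :
  (forall n, (N <= n)%N -> u n = 0) -> has_sum u (\sum_(n < N) u n).
Proof.
move=> u0; apply: cvg_near_cst; exists N => // n /= leNn.
rewrite /series /= (big_cat_nat (n:=N))//= big_mkord [X in _ + X]big_nat.
by rewrite [X in _ + X]big1 ?addr0// => i /andP[/u0].
Qed.

Lemma sumoo_finite u N :
  (forall n, (N <= n)%N -> u n = 0) -> sumoo u = \sum_(n < N) u n.
Proof. by move=> /has_sum_finite /(cvg_lim (@norm_hausdorff _ _)). Qed.

Lemma has_sum3_ext (u v : nat -> nat -> nat -> K) l :
  has_sum3 u l -> (forall n m k, u n m k = v n m k) -> has_sum3 v l.
Proof. by move=> ul uv; suff <- : u = v by []; do 3 apply/funext=> ?. Qed.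

Lemma has_sum3Z c (u : nat -> nat -> nat -> K) l :
  has_sum3 u l -> has_sum3 (fun n m k => c * u n m k) (c * l).
Proof.
move=> [v [w [uv vw wl]]]; exists (fun n m => c * v n m), (fun n => c * w n).
by split=> [n m|n|]; exact: has_sumZ.
Qed.
Arguments has_sum3Z c {u l} _.

Lemma has_sum3D (u u' : nat -> nat -> nat -> K) l l' :
  has_sum3 u l -> has_sum3 u' l' ->
  has_sum3 (fun n m k => u n m k + u' n m k) (l + l').
Proof.
move=> [v [w [uv vw wl]]] [v' [w' [uv' vw' wl']]].
exists (fun n m => v n m + v' n m), (fun n => w n + w' n).
by split=> [n m|n|]; exact: has_sumD.
Qed.

Lemma has_sum3_sum N (u : nat -> nat -> nat -> nat -> K) (l : nat -> K) :
  (forall i, has_sum3 (u i) (l i)) ->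
  has_sum3 (fun n m k => \sum_(i < N) u i n m k) (\sum_(i < N) l i).
Proof.
move=> ul; elim: N => [|N IHN].
  rewrite big_ord0; have := has_sum3Z 0 (ul 0%N); rewrite mul0r => u0.
  by apply: (has_sum3_ext u0) => n m k; rewrite big_ord0 mul0r.
rewrite big_ord_recr /=; apply: (has_sum3_ext (has_sum3D IHN (ul N))) => n m k.
by rewrite big_ord_recr.
Qed.

Lemma has_sum3_prod (f g h : nat -> K) lf lg lh :
  has_sum f lf -> has_sum g lg -> has_sum h lh ->
  has_sum3 (fun n m k => f n * g m * h k) (lf * lg * lh).
Proof.
move=> ff gg hh; exists (fun n m => f n * g m * lh), (fun n => f n * lg * lh).
split=> [n m|n|]; first exact: has_sumZ.
- rewrite mulrAC; apply: (has_sum_ext (has_sumZ (f n * lh) gg)) => m.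
  by rewrite mulrAC.
- rewrite -mulrA mulrC; apply: (has_sum_ext (has_sumZ (lg * lh) ff)) => n.
  by rewrite mulrC mulrA.
Qed.

Lemma cvg_norm_le u l B :
  (forall n, `|u n| <= B) -> u @ \oo --> l -> `|l| <= B.
Proof.
move=> uB ul; have B0 : B \is Num.real by rewrite ger0_real// (le_trans _ (uB 0%N)).
rewrite real_leNgt ?normr_real//; apply/negP => ltBl.
have [N _ /(_ N (leqnn N))] : \forall n \near \oo, `|l - u n| < `|l| - B.
  by apply: cvgr_dist_lt => //; rewrite subr_gt0.
move=> /= lt; have := ler_normD (l - u N) (u N); rewrite subrK => le1.
have := le_lt_trans le1 (ltr_leD lt (uB N)).
by rewrite subrK ltxx.
Qed.

End HasSum.
Arguments has_sumZ {K} c {u l} _.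
Arguments has_sum3Z {K} c {u l} _.

(** * Absolutely summable series *)

(** Absolutely convergent series converge. The completeness of the complex
    numbers enters only in this form, so that the rest makes sense over any
    numFieldType. *)
Definition abs_cvg_complete (K : numFieldType) : Prop :=
  forall (u : nat -> K) (B : K),
    (forall N, \sum_(n < N) `|u n| <= B) -> exists l, has_sum u l.

Section ComplexComplete.
Variable R : realType.
Local Notation C := (R[i] : numFieldType).

Lemma cvg_real_complex (f : nat -> R) (l : R) :
  f @ \oo --> l -> (fun n => (f n)%:C%C : C) @ \oo --> (l%:C%C : C).
Proof.
move=> fl; apply/cvgrPdist_lt => e e0.
have eE : e = (complex.Re e)%:C%C by rewrite RRe_real// gtr0_real.
have Re0 : 0 < complex.Re e by move: e0; rewrite eE ltcR.
near=> n; rewrite -rmorphB normc_def /= expr0n addr0 sqrtr_sqr eE ltcR.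
by near: n; exact: cvgr_dist_lt.
Unshelve. all: by end_near. Qed.

Lemma real_abs_bounded_cvg (f : nat -> R) (B : R) :
  (forall N, \sum_(n < N) `|f n| <= B) -> exists l : R, series f @ \oo --> l.
Proof.
move=> fB; apply/cvg_ex; apply: normed_cvg.
have -> : [normed series f] = series (fun n => `|f n|) by [].
apply: nondecreasing_is_cvgn.
  by apply/nondecreasing_seqP => n; rewrite seriesSr lerDl.
by exists B => _ [n _ <-]; rewrite /series /= big_mkord.
Qed.

(** Bounded partial sums of norms bound those of the real and of the imaginary
    parts, which converge since the real numbers are complete. *)
Lemma complex_abs_cvg_complete : abs_cvg_complete C.
Proof.
move=> u B uB.
have Re_le (z : R[i]) : `|complex.Re z| <= complex.Re `|z|.
  rewrite normc_def /= -sqrtr_sqr ler_wsqrtr// lerDl; exact: sqr_ge0.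
have Im_le (z : R[i]) : `|complex.Im z| <= complex.Re `|z|.
  rewrite normc_def /= -sqrtr_sqr ler_wsqrtr// lerDr; exact: sqr_ge0.
have ReB N : \sum_(n < N) complex.Re `|u n| <= complex.Re B.
  by have := uB N; rewrite lecE => /andP[_]; rewrite raddf_sum.
have [lr cvr] : exists l : R, series (fun n => complex.Re (u n)) @ \oo --> l.
  apply: (@real_abs_bounded_cvg _ (complex.Re B)) => N.
  by apply: le_trans (ReB N); apply: ler_sum.
have [li cvi] : exists l : R, series (fun n => complex.Im (u n)) @ \oo --> l.
  apply: (@real_abs_bounded_cvg _ (complex.Re B)) => N.
  by apply: le_trans (ReB N); apply: ler_sum.
exists (lr%:C%C + 'i%C * li%:C%C : C); rewrite /has_sum.
have -> : series u = (fun n =>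
    (series (fun n => complex.Re (u n)) n)%:C%C
    + 'i%C * (series (fun n => complex.Im (u n)) n)%:C%C).
  apply/funext => n; rewrite /series /= !raddf_sum /= mulr_sumr -big_split /=.
  by apply: eq_bigr => i _; rewrite -complexE.
by apply: cvgD; [|apply: cvgMl_tmp]; exact: cvg_real_complex.
Qed.

End ComplexComplete.

Section RatioTest.
Variables (K : numFieldType) (Kcomplete : abs_cvg_complete K).
Implicit Types (u : nat -> K) (z l : K).

(** The partial sums of the norms stay bounded because
    [(1 - r) * `|u n| <= `|u n| - `|u n.+1|], whose right-hand side telescopes. *)
Lemma ratio_bounded u r N0 : 0 <= r < 1 ->
  (forall n, (N0 <= n)%N -> `|u n.+1| <= r * `|u n|) ->
  exists B, forall N, \sum_(n < N) `|u n| <= B.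
Proof.
move=> /andP[r0 r1] ur.
have tele N : (1 - r) * \sum_(n < N) `|u (N0 + n)%N| <= `|u N0| - `|u (N0 + N)%N|.
  elim: N => [|N IHN]; first by rewrite big_ord0 mulr0 addn0 subrr.
  rewrite big_ord_recr /= mulrDr; apply: (le_trans (lerD IHN (lexx _))).
  rewrite mulrBl mul1r addrA subrK addnS; apply: lerB => //.
  by apply: ur; exact: leq_addr.
exists (\sum_(n < N0) `|u n| + `|u N0| / (1 - r)) => N.
apply: (@le_trans _ _ (\sum_(n < N0 + N) `|u n|)).
  by rewrite addnC big_split_ord /= lerDl sumr_ge0.
rewrite big_split_ord /= lerD2l ler_pdivlMr ?subr_gt0// mulrC.
by apply: (le_trans (tele N)); rewrite gerBl.
Qed.

Lemma ratio_test u (rho : nat -> K) l :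
  (forall n, u n.+1 = rho n * u n) -> rho @ \oo --> l -> `|l| < 1 ->
  exists B, forall N, \sum_(n < N) `|u n| <= B.
Proof.
move=> urho rhol l1; pose e := (1 - `|l|) / 2.
have e0 : 0 < e by rewrite divr_gt0// subr_gt0.
have [N0 _ HN0] : \forall n \near \oo, `|l - rho n| < e by exact: cvgr_dist_lt.
apply: (@ratio_bounded u (`|l| + e) N0).
  rewrite addr_ge0 ?(ltW e0)//= -ltrBrDl /e ltr_pdivrMr// mulr_natr mulr2n.
  by rewrite ltrDl subr_gt0.
move=> n N0n; rewrite urho normrM ler_wpM2r//.
rewrite -[rho n](subKr l) (le_trans (ler_normB _ _))// lerD2l ltW//.
exact: HN0.
Qed.

(** The geometric series converges by the ratio test; this does without an
    Archimedean order. *)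
Lemma cvg_abs_exp z : `|z| < 1 -> (fun n => z ^+ n) @ \oo --> 0.
Proof.
move=> z1; have [||B zB] := @ratio_test (fun n => z ^+ n) (fun=> z) z _ _ z1.
- by move=> n; rewrite exprS.
- exact: cvg_cst.
have [l zl] := Kcomplete zB.
by apply: cvg_series_cvg_0; apply/cvg_ex; exists l.
Qed.

End RatioTest.

(** * Euler's two expansions of the infinite q-shifted factorial *)

Section QPochhammer.
Variable K : numFieldType.
Implicit Types (a q z : K).

Lemma qpoch0 a q : qpoch a q 0 = 1.
Proof. by rewrite /qpoch big_ord0. Qed.

Lemma qpochSr a q n : qpoch a q n.+1 = qpoch a q n * (1 - a * q ^+ n).
Proof. by rewrite /qpoch big_ord_recr. Qed.

Lemma qpochSl a q n : qpoch a q n.+1 = (1 - a) * qpoch (a * q) q n.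
Proof.
rewrite /qpoch big_ord_recl expr0 mulr1; congr (_ * _).
by apply: eq_bigr => i _; rewrite -mulrA -exprS.
Qed.

Lemma qpoch_neq0 a q n : (forall k, a * q ^+ k != 1) -> qpoch a q n != 0.
Proof.
by move=> aq; apply/prodf_neq0 => i _; rewrite subr_eq0 eq_sym.
Qed.

Lemma mul_expr_neq1 z q n : `|z| < 1 -> `|q| < 1 -> z * q ^+ n != 1.
Proof.
move=> z1 q1; apply/eqP => /(congr1 Num.norm)/eqP; rewrite normr1 normrM normrX.
by rewrite lt_eqF// (le_lt_trans _ z1)// ler_piMr// exprn_ile1// ltW.
Qed.

Lemma qpochq_neq0 q n : `|q| < 1 -> qpoch q q n != 0.
Proof. by move=> q1; apply: qpoch_neq0 => k; exact: mul_expr_neq1. Qed.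

End QPochhammer.

Section Euler.
Variables (K : numFieldType) (Kcomplete : abs_cvg_complete K).
Variables (q : K) (q1 : `|q| < 1).
Implicit Types (c : nat -> K) (z l : K).

Let q_neq1 n : 1 - q * q ^+ n != 0.
Proof. by rewrite subr_eq0 eq_sym mul_expr_neq1. Qed.

Let cvg_1qS : (fun n => (1 - q * q ^+ n)^-1) @ \oo --> (1 : K).
Proof.
have cvg1 : (fun n => 1 - q * q ^+ n) @ \oo --> (1 - q * 0 : K).
  by apply: cvgB; [exact: cvg_cst|apply: cvgMl_tmp; exact: cvg_abs_exp].
rewrite mulr0 subr0 in cvg1; rewrite -[X in _ --> X]invr1.
exact: (cvgV (oner_neq0 K)).
Qed.

(** A power series evaluated along [q ^+ N * z] tends to its constant
    coefficient, because the remaining terms carry at least one factor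
    [q ^+ N]. *)
Lemma cvg_power_series0 c z (L : nat -> K) B :
  (forall N, \sum_(n < N) `|c n * z ^+ n| <= B) ->
  (forall N, has_sum (fun n => c n * (q ^+ N * z) ^+ n) (L N)) ->
  L @ \oo --> c 0%N.
Proof.
move=> cB cL.
have LB N : `|L N - c 0%N| <= `|q ^+ N| * B.
  apply: (@cvg_norm_le _ (fun M => series (fun n => c n * (q ^+ N * z) ^+ n) M.+1 - c 0%N)).
    move=> M; rewrite /series /= big_mkord big_ord_recl expr0 mulr1 addrC addKr.
    rewrite (le_trans (ler_norm_sum _ _ _))// (le_trans _ (ler_wpM2l _ (cB M.+1)))//.
    rewrite big_ord_recl mulrDr mulr_sumr ler_wpDl ?mulr_ge0//.
    apply: ler_sum => i _; rewrite exprMn mulrCA [leLHS]normrM ler_wpM2r//.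
    rewrite normrX exprS ler_piMr// exprn_ile1// normrX exprn_ile1// ltW//.
  apply: cvgB; last exact: cvg_cst.
  by rewrite (cvg_shiftS (series _)); exact: cL.
have qNB : (fun N => `|q ^+ N| * B) @ \oo --> 0.
  rewrite -(mul0r B); apply: cvgMr_tmp; rewrite -(normr0 K).
  by apply: cvg_norm; exact: cvg_abs_exp.
apply/cvgrPdist_lt => e e0; near=> N.
rewrite distrC (le_lt_trans (LB N))//.
have B0 : 0 <= B by apply: le_trans (cB 0%N); rewrite big_ord0.
rewrite -[ltLHS]ger0_norm ?mulr_ge0//.
rewrite -normrN -sub0r; near: N; exact: cvgr_dist_lt.
Unshelve. all: by end_near. Qed.



Definition euler_coef n : K := (- 1) ^+ n * q ^+ 'C(n, 2) / qpoch q q n.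

Lemma euler_coef0 : euler_coef 0 = 1.
Proof. by rewrite /euler_coef qpoch0 mulr1 divr1. Qed.

Lemma euler_coefS n :
  euler_coef n.+1 = - q ^+ n / (1 - q * q ^+ n) * euler_coef n.
Proof.
have qn0 := qpochq_neq0 n q1; have qS := q_neq1 n.
rewrite /euler_coef qpochSr binS bin1 exprS exprD.
by field; rewrite qS qn0.
Qed.

Lemma euler_bounded z :
  exists B, forall N, \sum_(n < N) `|euler_coef n * z ^+ n| <= B.
Proof.
apply: (@ratio_test _ (fun n => euler_coef n * z ^+ n)
  (fun n => - z * q ^+ n * (1 - q * q ^+ n)^-1) 0).
- by move=> n; rewrite euler_coefS exprS; ring.
- rewrite -(mulr0 (- z)) -[X in _ --> X]mulr1; apply: cvgM => //.
  by apply: cvgMl_tmp; exact: cvg_abs_exp.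
- by rewrite normr0.
Qed.

Lemma has_sum_euler_coef z : exists l, has_sum (fun n => euler_coef n * z ^+ n) l.
Proof. by have [B zB] := euler_bounded z; exact: Kcomplete zB. Qed.

(** [E z = \sum_n euler_coef n * z ^+ n] satisfies [E z = (1 - z) * E (q * z)],
    which iterates to [E z = qpoch z q N * E (q ^+ N * z)]; the last factor
    tends to [1].  This also shows that the infinite product converges. *)
Lemma qpoch_cvg_euler z l :
  has_sum (fun n => euler_coef n * z ^+ n) l -> qpoch z q @ \oo --> l.
Proof.
move=> zl; have [L HL] := choice (fun N => has_sum_euler_coef (q ^+ N * z)).
have [B zB] := euler_bounded z.
have L1 : L @ \oo --> (1 : K).
  by rewrite -euler_coef0; exact: (cvg_power_series0 zB HL).
have step N : L N = (1 - z * q ^+ N) * L N.+1.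
  have diff : has_sum (fun n => euler_coef n * (q ^+ N * z) ^+ n
      - euler_coef n * (q ^+ N.+1 * z) ^+ n) (- (z * q ^+ N) * L N.+1).
    apply: has_sum_shift; first by rewrite !expr0 subrr.
    apply: (has_sum_ext (has_sumZ (- (z * q ^+ N)) (HL N.+1))) => n.
    have qS := q_neq1 n; rewrite euler_coefS !exprMn -!exprM exprS.
    rewrite ![(N.+1 * _)%N]mulSn ![(N * _.+1)%N]mulnS !exprD.
    by rewrite !exprS; field.
  have := has_sum_unique diff (has_sumB (HL N) (HL N.+1)).
  by move=> /(canLR (subrK _)) <-; ring.
have lE N : l = qpoch z q N * L N.
  elim: N => [|N ->]; last by rewrite qpochSr {1}step mulrA.
  rewrite qpoch0 mul1r; apply: has_sum_unique zl _.
  by apply: (has_sum_ext (HL 0%N)) => n; rewrite expr0 mul1r.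
have lL : (fun N => l * (L N)^-1) @ \oo --> l.
  rewrite -[X in _ --> X]mulr1 -[X in _ * X]invr1; apply: cvgMl_tmp.
  exact: (cvgV (oner_neq0 K)).
apply: cvg_trans lL; apply: near_eq_cvg.
have [N0 _ LN0] := cvgr_neq0 _ L1 (oner_neq0 K).
by exists N0 => // n /LN0 /= Ln0; rewrite {1}(lE n) mulfK.
Qed.


Lemma qpoch_cvg {z} : qpoch z q @ \oo --> qpochoo z q.
Proof.
have [l zl] := has_sum_euler_coef z; have := qpoch_cvg_euler zl.
by move=> zl'; rewrite /qpochoo (cvg_lim (@norm_hausdorff _ _) zl').
Qed.

Lemma has_sum_qpochoo z : has_sum (fun n => euler_coef n * z ^+ n) (qpochoo z q).
Proof.
have [l zl] := has_sum_euler_coef z; have := qpoch_cvg_euler zl.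
by move=> zl'; rewrite /qpochoo (cvg_lim (@norm_hausdorff _ _) zl').
Qed.

(** [e z = \sum_n z ^+ n / qpoch q q n] satisfies [(1 - z) * e z = e (q * z)],
    which iterates to [qpoch z q N * e z = e (q ^+ N * z)], and the right-hand
    side tends to [1]. *)
Lemma has_sum_inv_qpochoo z : `|z| < 1 ->
  qpochoo z q != 0 /\ has_sum (fun n => z ^+ n / qpoch q q n) (qpochoo z q)^-1.
Proof.
move=> z1.
have term_bounded x : `|x| < 1 ->
    exists B, forall N, \sum_(n < N) `|(qpoch q q n)^-1 * x ^+ n| <= B.
  apply: (@ratio_test _ (fun n => (qpoch q q n)^-1 * x ^+ n)
    (fun n => x * (1 - q * q ^+ n)^-1)).
    by move=> n; rewrite qpochSr invfM exprS; ring.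
  by rewrite -[X in _ --> X]mulr1; exact: cvgMl_tmp.
have qNz1 N : `|q ^+ N * z| < 1.
  rewrite normrM (le_lt_trans _ z1)// ler_piMl// normrX exprn_ile1//.
  exact: ltW.
have ex N : exists l, has_sum (fun n => (qpoch q q n)^-1 * (q ^+ N * z) ^+ n) l.
  by have [B zB] := term_bounded _ (qNz1 N); exact: Kcomplete zB.
have [L HL] := choice ex.
have [B zB] := term_bounded _ z1.
have L1 : L @ \oo --> (1 : K).
  by rewrite -[X in _ --> X]invr1 -(qpoch0 q q); exact: (cvg_power_series0 zB HL).
have step N : L N.+1 = (1 - z * q ^+ N) * L N.
  have diff : has_sum (fun n => (qpoch q q n)^-1 * (q ^+ N * z) ^+ n
      - (qpoch q q n)^-1 * (q ^+ N.+1 * z) ^+ n) (z * q ^+ N * L N).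
    apply: has_sum_shift; first by rewrite !expr0 subrr.
    apply: (has_sum_ext (has_sumZ (z * q ^+ N) (HL N))) => n.
    have qS := q_neq1 n; have qn0 := qpochq_neq0 n q1.
    rewrite qpochSr !exprMn -!exprM.
    rewrite ![(N.+1 * _)%N]mulSn ![(N * _.+1)%N]mulnS !exprD.
    by rewrite !exprS; field; rewrite qS qn0.
  have := has_sum_unique diff (has_sumB (HL N) (HL N.+1)).
  by move=> dE; rewrite mulrBl mul1r dE subKr.
have LE N : qpoch z q N * L 0%N = L N.
  elim: N => [|N IHN]; first by rewrite qpoch0 mul1r.
  by rewrite qpochSr step -IHN; ring.
have prod1 : qpochoo z q * L 0%N = 1.
  have cvgL : (fun N => qpoch z q N * L 0%N) @ \oo --> qpochoo z q * L 0%N.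
    by apply: cvgMr_tmp; exact: qpoch_cvg.
  move: cvgL; under eq_fun do rewrite LE.
  by move=> cvgL; exact: (cvg_unique (@norm_hausdorff _ K) cvgL L1).
have z0 : qpochoo z q != 0.
  by apply/eqP => z0; move/eqP: prod1; rewrite z0 mul0r eq_sym oner_eq0.
split=> //; have -> : (qpochoo z q)^-1 = L 0%N.
  by apply: (mulfI z0); rewrite prod1 divff.
by apply: (has_sum_ext (HL 0%N)) => n; rewrite expr0 mul1r mulrC.
Qed.

Lemma qpochooS z : qpochoo z q = (1 - z) * qpochoo (z * q) q.
Proof.
have cvgl : (fun n => qpoch z q n.+1) @ \oo --> qpochoo z q.
  by rewrite (cvg_shiftS (qpoch z q)); exact: qpoch_cvg.
have cvgr : (fun n => qpoch z q n.+1) @ \oo --> (1 - z) * qpochoo (z * q) q.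
  under eq_fun do rewrite qpochSl.
  by apply: cvgMl_tmp; exact: qpoch_cvg.
exact: (cvg_unique (@norm_hausdorff _ K) cvgl cvgr).
Qed.

End Euler.

(** * The part of the series that is homogeneous of degree j in x *)

Section Degree.
Variables (K : numFieldType) (Kcomplete : abs_cvg_complete K).
Variables (q : K) (q0 : q != 0) (q1 : `|q| < 1).
Variables (t s w : K) (t0 : t != 0) (w0 : w != 0).
Implicit Types (a b : seq K) (x y z : K) (E : nat -> K).

Lemma has_sum3_rogers_weight y : `|y * w| < 1 ->
  has_sum3 (fun n m k => rogers_weight q t s w n m k * y ^+ (n + m + k))
    (qpochoo (y * t) q * qpochoo (y * s) q / qpochoo (y * w) q).
Proof.
move=> yw1; have [_ ywE] := has_sum_inv_qpochoo Kcomplete q1 yw1.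
have ytE := has_sum_qpochoo Kcomplete q1 (z := y * t).
have ysE := has_sum_qpochoo Kcomplete q1 (z := y * s).
apply: (has_sum3_ext (has_sum3_prod ytE ysE ywE)) => n m k.
rewrite /rogers_weight /euler_coef !exprD !exprMn; ring.
Qed.

(** [q_factor j (q ^+ N)] times [y ^+ N] is the result of applying the operator
    [prod_(i < j) (q ^+ i * eta - 1)] to [y ^+ N], where [eta] is the dilation
    [y |-> y / q].  Up to a factor, this operator is the j-th q-difference
    quotient. *)
Definition q_factor j z : K := \prod_(i < j) (q ^+ i / z - 1).

Lemma q_factorS j N y :
  y ^+ N * q_factor j.+1 (q ^+ N) =
  q ^+ j * ((y / q) ^+ N * q_factor j (q ^+ N)) - y ^+ N * q_factor j (q ^+ N).
Proof.
by rewrite /q_factor big_ord_recr /= expr_div_n; ring.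
Qed.

(** The function [y |-> (y t, y s; q)_oo / (y w; q)_oo] with its first and third
    factors dilated l times. *)
Definition dilated l y : K :=
  qpochoo (y * t / q ^+ l) q * qpochoo (y * s) q / qpochoo (y * w / q ^+ l) q.

Lemma norm_div_qexp_lt1 z l : (`|z / q ^+ l| < 1) = (`|z| < `|q| ^+ l).
Proof.
by rewrite normrM normfV normrX ltr_pdivrMr ?mul1r// exprn_gt0// normr_gt0.
Qed.

Lemma qpochoo_div z l :
  qpochoo (z / q ^+ l.+1) q = (1 - z / q ^+ l.+1) * qpochoo (z / q ^+ l) q.
Proof.
rewrite (qpochooS Kcomplete q1) exprSr invfM; congr (_ * qpochoo _ _).
by rewrite -!mulrA mulVf// mulr1.
Qed.

(** The product rule for the difference operator [y |-> y / q] minus the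
    identity: dilating the quotient of the second and third factors gives the
    term in [dilated l.+1], and dilating the first factor the term in
    [dilated l]. *)
Lemma dilated_diff l y : `|y * w| < `|q| ^+ l.+1 ->
  dilated l (y / q) - dilated l y =
  y * (w / q ^+ l.+1 * (1 - s / w * q ^+ l) * dilated l.+1 y
       - t / q ^+ l.+1 * dilated l y).
Proof.
move=> yw; have ql0 : q ^+ l != 0 by exact: expf_neq0.
have divqS z : y / q * z / q ^+ l = y * z / q ^+ l.+1.
  by rewrite exprS; field; rewrite ql0 q0.
have := has_sum_inv_qpochoo Kcomplete q1 (z := y * w / q ^+ l.+1).
rewrite norm_div_qexp_lt1 => /(_ yw)[W0 _].
rewrite /dilated !divqS; have -> : y / q * s = y * s / q ^+ 1 by rewrite expr1 mulrAC.
move: W0; rewrite !(qpochoo_div _ l) (qpochoo_div _ 0) expr0 expr1 divr1.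
rewrite mulf_eq0 negb_or => /andP[W1 W0].
have W2 : q * q ^+ l - y * w != 0.
  have -> : q * q ^+ l - y * w = q ^+ l.+1 * (1 - y * w / q ^+ l.+1).
    by rewrite exprS; field; rewrite ql0 q0.
  by rewrite mulf_neq0// expf_neq0.
by rewrite exprS; field; rewrite W0 w0 q0 ql0 W2.
Qed.

(** [dilated l] is the product occurring in the l-th term of the q-Leibniz rule,
    and [degree_coef j l] is its coefficient in the j-th difference quotient, up
    to the common factor in [degree_sum]. The factor [(w / t) ^+ l] cancels
    against the one produced by [dilatedE]. *)
Definition degree_coef j l : K :=
  qpoch (q ^- j) q l / qpoch q q l * q ^+ l * (w / t) ^+ l * qpoch (s / w) q l.

Lemma qpoch_qNexp_eq0 j l : (j < l)%N -> qpoch (q ^- j) q l = 0.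
Proof.
move=> jl; rewrite /qpoch (bigD1 (Ordinal jl)) //= mulVf ?expf_neq0//.
by rewrite subrr mul0r.
Qed.

(** The q-Pascal rule for these coefficients. *)
Lemma degree_coefSS j l :
  degree_coef j.+1 l.+1 = degree_coef j l.+1 / q ^+ l.+1
    - degree_coef j l * (w / t) / q ^+ l * (1 - s / w * q ^+ l).
Proof.
have ql0 : q ^+ l != 0 by exact: expf_neq0.
have qj0 : q ^+ j != 0 by exact: expf_neq0.
have qS : 1 - q * q ^+ l != 0 by rewrite subr_eq0 eq_sym mul_expr_neq1.
have qn0 := qpochq_neq0 l q1.
have qjq : q ^- j.+1 * q = q ^- j by rewrite exprSr invfM mulfVK.
rewrite /degree_coef (qpochSl (q ^- j.+1)) qjq !qpochSr !exprS.
by field; rewrite t0 w0 q0 ql0 qj0 qn0 qS.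
Qed.

Definition degree_sum j y : K :=
  (- t * y / q) ^+ j * \sum_(l < j.+1) degree_coef j l * dilated l y.

Lemma degree_sumS j y : `|y * w| < `|q| ^+ j.+1 ->
  degree_sum j.+1 y = q ^+ j * degree_sum j (y / q) - degree_sum j y.
Proof.
move=> yw.
have diff (l : 'I_j.+1) : dilated l (y / q) - dilated l y =
    y * (w / q ^+ l.+1 * (1 - s / w * q ^+ l) * dilated l.+1 y
         - t / q ^+ l.+1 * dilated l y).
  apply: dilated_diff; apply: (lt_le_trans yw).
  by rewrite ler_wiXn2l// ltW.
have qj0 : q ^+ j != 0 by exact: expf_neq0.
have -> : q ^+ j * degree_sum j (y / q) - degree_sum j y =
    (- t * y / q) ^+ j *
    \sum_(l < j.+1) degree_coef j l * (dilated l (y / q) - dilated l y).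
  rewrite /degree_sum mulrA -exprMn.
  have -> : q * (- t * (y / q) / q) = - t * y / q by field.
  by rewrite -mulrBr -sumrB; congr (_ * _); apply: eq_bigr => l _; rewrite mulrBr.
rewrite /degree_sum exprSr -mulrA; congr (_ * _).
have -> : \sum_(l < j.+1) degree_coef j l * (dilated l (y / q) - dilated l y) =
   - t * y / q * (\sum_(l < j.+1) degree_coef j l / q ^+ l * dilated l y
     - \sum_(l < j.+1) degree_coef j l * (w / t) / q ^+ l * (1 - s / w * q ^+ l)
                       * dilated l.+1 y).
  rewrite -sumrB mulr_sumr; apply: eq_bigr => l _; rewrite diff exprS.
  by field; rewrite t0 w0 q0 expf_neq0.
congr (_ * _).
rewrite big_ord_recl /=; under eq_bigr do rewrite /bump/= add1n degree_coefSS mulrBl.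
rewrite sumrB addrA; congr (_ - _).
(* Without the vanishing term of index [j.+1] the ranges of the sums agree. *)
rewrite [in RHS]big_ord_recl /= [in LHS]big_ord_recr /=.
have -> : degree_coef j j.+1 = 0 by rewrite /degree_coef qpoch_qNexp_eq0// !mul0r.
rewrite !mul0r addr0.
congr (_ + _); first by rewrite /degree_coef !qpoch0 !expr0 !divr1.
Qed.

(** Since [q_factorS] and [degree_sumS] are the same recursion, induction on [j],
    for all [y] at the same time, reduces the claim to Euler's expansions. *)
Lemma has_sum3_degree j y : `|y * w| < `|q| ^+ j ->
  has_sum3 (fun n m k => rogers_weight q t s w n m k *
      (y ^+ (n + m + k) * q_factor j (q ^+ (n + m + k)))) (degree_sum j y).
Proof.
elim: j y => [|j IHj] y yw.
  have -> : degree_sum 0 y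
      = qpochoo (y * t) q * qpochoo (y * s) q / qpochoo (y * w) q.
    rewrite /degree_sum big_ord1 /degree_coef !qpoch0 /dilated !expr0.
    by rewrite !divr1 !mul1r.
  apply: (has_sum3_ext (has_sum3_rogers_weight yw)) => n m k.
  by rewrite /q_factor big_ord0 mulr1.
rewrite degree_sumS// -[- _]mulN1r.
have yqw : `|y / q * w| < `|q| ^+ j.
  by rewrite mulrAC normrM normfV ltr_pdivrMr ?normr_gt0// -exprSr.
have yw' : `|y * w| < `|q| ^+ j.
  by apply: (lt_le_trans yw); rewrite ler_wiXn2l// ltW.
apply: (has_sum3_ext (has_sum3D (has_sum3Z (q ^+ j) (IHj _ yqw))
  (has_sum3Z (-1) (IHj _ yw')))) => n m k.
by rewrite q_factorS; ring.
Qed.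

Lemma exprz_subn m n : q ^ (m%:Z - n%:Z) = q ^+ m / q ^+ n.
Proof. by rewrite expfzDr// -exprnN. Qed.

(** Gauss's [(q; q)_N / (q; q)_(N - j)] is, up to a power of [q], the polynomial
    [q_factor j] in [q ^- N]. *)
Lemma qpoch_q_factor N j : (j <= N)%N ->
  qpoch q q N * q ^ ('C(j.+1, 2)%:Z - (N * j)%:Z) =
  qpoch q q (N - j) * q ^+ j * q_factor j (q ^+ N).
Proof.
rewrite exprz_subn; elim: j => [|j IHj] jN.
  by rewrite muln0 subn0 /q_factor big_ord0 expr0 divr1 !mulr1.
have := IHj (ltnW jN); rewrite -(subnSK jN) qpochSr => IH.
have NE : q ^+ N = q ^+ j * q * q ^+ (N - j.+1) by rewrite -exprSr -exprD subnKC.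
have qj0 : q ^+ j != 0 by exact: expf_neq0.
have qd0 : q ^+ (N - j.+1) != 0 by exact: expf_neq0.
have -> : q_factor j.+1 (q ^+ N) = q_factor j (q ^+ N) * (q ^+ j / q ^+ N - 1).
  by rewrite /q_factor big_ord_recr.
have binE : 'C(j.+2, 2) = ('C(j.+1, 2) + j.+1)%N by rewrite binS bin1.
rewrite binE mulnS (exprD q 'C(j.+1, 2) j.+1) (exprD q N).
have -> : qpoch q q N * (q ^+ 'C(j.+1, 2) * q ^+ j.+1 / (q ^+ N * q ^+ (N * j))) =
    qpoch q q N * (q ^+ 'C(j.+1, 2) / q ^+ (N * j)) * (q ^+ j.+1 / q ^+ N).
  by rewrite invfM; ring.
by rewrite IH NE exprSr; field; rewrite q0 qj0 qd0.
Qed.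

(** For [N < j] both sides vanish, the right-hand side because the factor of
    index [N] of [q_factor] is zero; so [psi_term] is given by a single
    expression for all [N]. *)
Lemma psi_termE a b x y N j : y != 0 ->
  psi_term a b x y q N j =
  qpochs a q j / qpochs b q j / qpoch q q j * (- (x * q / y)) ^+ j *
  (y ^+ N * q_factor j (q ^+ N)).
Proof.
move=> y0; rewrite /psi_term; case: leqP => [jN|Nj]; last first.
  rewrite /q_factor (bigD1 (Ordinal Nj))//= divff ?expf_neq0// subrr.
  by rewrite mul0r !mulr0.
have qj0 : q ^+ j != 0 by exact: expf_neq0.
have yj0 : y ^+ j != 0 by exact: expf_neq0.
have Q1 := qpochq_neq0 j q1; have Q2 := qpochq_neq0 (N - j) q1.
have FE : q_factor j (q ^+ N) =
    qpoch q q N * q ^ ('C(j.+1, 2)%:Z - (N * j)%:Z) / (qpoch q q (N - j) * q ^+ j).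
  by rewrite (qpoch_q_factor jN); field; rewrite Q2 qj0.
rewrite FE /qbinom -[in y ^+ N](subnK jN) exprD [in RHS]exprNn expr_div_n exprMn.
set A := qpochs a q j / _; set z := q ^ _.
by field; rewrite Q1 Q2 qj0 yj0.
Qed.

(** The factor produced by the dilation in [qpochoo_div_qexp] which, being
    independent of [z], cancels in quotients of infinite products. *)
Definition dilation_const l : K := \prod_(i < l) (- (q ^+ i.+1)^-1).

Lemma qpochoo_div_qexp z l : z != 0 ->
  qpochoo (z / q ^+ l) q = z ^+ l * dilation_const l * qpoch (q / z) q l * qpochoo z q.
Proof.
move=> z0; elim: l => [|l IHl].
  by rewrite /dilation_const big_ord0 qpoch0 !expr0 divr1 !mul1r.
have ql0 : q ^+ l != 0 by exact: expf_neq0.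
rewrite qpochoo_div IHl /dilation_const big_ord_recr /= qpochSr !exprS.
by field; rewrite q0 z0 ql0.
Qed.

Lemma dilatedE l y : y != 0 -> (forall k, q / (y * w) * q ^+ k != 1) ->
  `|y * w| < 1 ->
  dilated l y = rogers_prefactor y q t s w * (t / w) ^+ l *
    (qpoch (q / (y * t)) q l / qpoch (q / (y * w)) q l).
Proof.
move=> y0 yw_nopole yw1; have yw0 : y * w != 0 by rewrite mulf_neq0.
have [Y0 _] := has_sum_inv_qpochoo Kcomplete q1 yw1.
have P0 : qpoch (q / (y * w)) q l != 0 by exact: qpoch_neq0.
have dilation_const_neq0 : dilation_const l != 0.
  by apply/prodf_neq0 => i _; rewrite oppr_eq0 invr_eq0 expf_neq0.
rewrite /dilated !qpochoo_div_qexp ?mulf_neq0// /rogers_prefactor /qpochsoo.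
rewrite !big_cons big_nil mulr1 expr_div_n !exprMn.
by field; rewrite Y0 P0 dilation_const_neq0 !expf_neq0.
Qed.

(** The series terminates because of its numerator parameter [q ^- j]. *)
Lemma Phi32_finite j (be al2 al3 z : K) :
  Phi32 (q ^- j) al2 al3 be 0 q z =
  \sum_(l < j.+1) qpoch (q ^- j) q l * qpoch al2 q l * qpoch al3 q l
    / qpoch be q l * (z ^+ l / qpoch q q l).
Proof.
rewrite /Phi32 (@sumoo_finite _ _ j.+1) => [|l jl]; last first.
  by rewrite /qpochs big_cons qpoch_qNexp_eq0// !mul0r.
apply: eq_bigr => l _; rewrite /qpochs !big_cons !big_nil !mulr1 !mulrA.
suff -> : qpoch 0 q l = 1 by rewrite mulr1.
by rewrite /qpoch big1// => i _; rewrite mul0r subr0.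
Qed.

(** The powers of [- (x * q / y)] from [psi_termE] and of [- t * y / q] from
    [degree_sum] combine into the power of [x * t]. *)
Lemma has_sum3_psi_term a b x y j : y != 0 ->
  (forall k, q / (y * w) * q ^+ k != 1) ->
  `|y * w| < 1 -> `|y * w| < `|q| ^+ j ->
  has_sum3 (fun n m k =>
      rogers_weight q t s w n m k * psi_term a b x y q (n + m + k) j)
    (rogers_prefactor y q t s w * rogers_rhs_term a b x y q t s w j).
Proof.
move=> y0 yw_nopole yw1 ywj.
pose A := qpochs a q j / qpochs b q j / qpoch q q j * (- (x * q / y)) ^+ j.
have -> : rogers_prefactor y q t s w * rogers_rhs_term a b x y q t s w j =
    A * degree_sum j y.
  have sumE : \sum_(l < j.+1) degree_coef j l * dilated l y =
      rogers_prefactor y q t s w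
      * Phi32 (q ^- j) (q / (y * t)) (s / w) (q / (y * w)) 0 q q.
    rewrite Phi32_finite mulr_sumr; apply: eq_bigr => l _.
    have P0 : qpoch (q / (y * w)) q l != 0 by exact: qpoch_neq0.
    have Q0 := qpochq_neq0 l q1.
    rewrite dilatedE// /degree_coef !expr_div_n.
    by field; rewrite P0 Q0 !expf_neq0.
  have xtE : x * t = - (x * q / y) * (- t * y / q) by field; rewrite q0 y0.
  have qbE : qpochs (q :: b) q j = qpochs b q j * qpoch q q j.
    by rewrite /qpochs big_cons mulrC.
  by rewrite /rogers_rhs_term /A /degree_sum sumE xtE qbE exprMn invfM; ring.
apply: (has_sum3_ext (has_sum3Z A (has_sum3_degree ywj))) => n m k.
by rewrite psi_termE// /A; ring.
Qed.

End Degree.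

(** * Only finitely many degrees occur *)

Section Degrees.
Variables (K : numFieldType) (Kcomplete : abs_cvg_complete K).

Lemma ler_sum_term N (F : nat -> K) i : (forall k, 0 <= F k) -> (i < N)%N ->
  F i <= \sum_(k < N) F k.
Proof.
by move=> F0 iN; rewrite (bigD1 (Ordinal iN))//= lerDl sumr_ge0.
Qed.

Lemma abs_summable4_slice (u : nat -> nat -> nat -> nat -> K) n m i :
  abs_summable4 u ->
  exists B, forall N, \sum_(k < N) `|u n m k i| <= B.
Proof.
move=> [B uB]; exists B => N; pose M := (N + (n + m + i).+1)%N.
have [nM mM iM] : [/\ n < M, m < M & i < M]%N.
  by rewrite /M; split; rewrite !addnS ltnS ?addnA; lia.
apply: le_trans (uB M).
apply: le_trans (@ler_sum_term M (fun n => \sum_(m < M) \sum_(k < M) \sum_(i < M)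
  `|u n m k i|) n _ nM); last by move=> ?; do 3 (apply: sumr_ge0 => ? _).
apply: le_trans (@ler_sum_term M (fun m => \sum_(k < M) \sum_(i < M)
  `|u n m k i|) m _ mM); last by move=> ?; do 2 (apply: sumr_ge0 => ? _).
apply: (@le_trans _ _ (\sum_(k < M) `|u n m k i|)).
  by rewrite big_split_ord /= lerDl sumr_ge0.
by apply: ler_sum => k _; exact: (@ler_sum_term M (fun i => `|u n m k i|) i).
Qed.

Variables (q : K) (q0 : q != 0) (q1 : `|q| < 1).
Variables (t s w x y : K) (w0 : w != 0) (y0 : y != 0).
Variables (a b : seq K).

(** Along [n = m = 0] the terms of degree [j] are a constant multiple of
    [(y * w / q ^+ j) ^+ d / qpoch q q d] where [k = d + j]. They tend to zero,
    and so does their product with the convergent sequence [qpoch q q]; hence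
    the base of the remaining power has norm less than one. *)
Lemma abs_summable4_degree j :
  abs_summable4 (fun n m k j =>
    rogers_weight q t s w n m k * psi_term a b x y q (n + m + k) j) ->
  qpochs a q j / qpochs b q j * x ^+ j != 0 -> `|y * w| < `|q| ^+ j.
Proof.
move=> summable Ax0.
have [B uB] := abs_summable4_slice 0 0 j summable.
pose u k := rogers_weight q t s w 0 0 k * psi_term a b x y q (0 + 0 + k) j.
have [l ul] := Kcomplete (u := u) uB.
have u0 : u @ \oo --> 0 by apply: cvg_series_cvg_0; apply/cvg_ex; exists l.
pose c := qpochs a q j / qpochs b q j * x ^+ j *
  ((- w) ^+ j * q ^+ 'C(j.+1, 2) / q ^+ (j * j) / qpoch q q j).
have c0 : c != 0.
  apply: mulf_neq0 => //.
  by rewrite !mulf_neq0 ?invr_eq0 ?qpochq_neq0 ?expf_neq0 ?oppr_eq0.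
have geomE d : u (d + j)%N * qpoch q q d = c * (y * w / q ^+ j) ^+ d.
  have weightE k : rogers_weight q t s w 0 0 k = w ^+ k / qpoch q q k.
    by rewrite /rogers_weight bin0n !addn0 !expr0 !qpoch0 !divr1 !mul1r.
  have Q1 := qpochq_neq0 j q1; have Q2 := qpochq_neq0 d q1.
  have Q3 := qpochq_neq0 (d + j) q1.
  rewrite /u weightE /psi_term !add0n leq_addl /qbinom addnK exprz_subn// /c.
  rewrite mulnDl (exprD q (d * j)) (mulnC d) exprM exprD [in RHS]exprNn.
  rewrite expr_div_n exprMn.
  set A := qpochs a q j / _.
  by field; rewrite Q1 Q2 Q3 !expf_neq0.
have cvg_geom : (fun d => c * (y * w / q ^+ j) ^+ d) @ \oo --> (0 : K).
  under eq_fun do rewrite -geomE.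
  rewrite -(mul0r (qpochoo q q)); apply: cvgM; last exact: qpoch_cvg.
  by rewrite -(cvg_shiftn j) in u0.
rewrite -norm_div_qexp_lt1// real_ltNge ?normr_real ?real1//; apply/negP => ge1.
have [N _ /(_ N (leqnn N)) /=] :
    \forall d \near \oo, `|0 - c * (y * w / q ^+ j) ^+ d| < `|c|.
  by apply: cvgr_dist_lt => //; rewrite normr_gt0.
rewrite sub0r normrN normrM normrX => lt_c.
have := lt_le_trans lt_c (ler_peMr (normr_ge0 c) (exprn_ege1 N ge1)).
by rewrite ltxx.
Qed.

Lemma psi_term_eq0 j N :
  qpochs a q j / qpochs b q j * x ^+ j = 0 -> psi_term a b x y q N j = 0.
Proof.
move=> Aj; rewrite psi_termE//.
have -> : - (x * q / y) = x * (- q / y) by ring.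
rewrite exprMn; set A := qpochs a q j / _ in Aj *.
have -> (Q P Y : K) : A / Q * (x ^+ j * P) * Y = A * x ^+ j * (P / Q * Y) by ring.
by rewrite Aj mul0r.
Qed.

Lemma psi_term_sum_finite J N :
  (forall j, (J <= j)%N -> qpochs a q j / qpochs b q j * x ^+ j = 0) ->
  psi a b x y q N = \sum_(j < J) psi_term a b x y q N j.
Proof.
move=> A0; apply: (has_sum_unique (u := psi_term a b x y q N)).
  by apply: has_sum_finite => j Nj; rewrite /psi_term leqNgt Nj.
by apply: has_sum_finite => j /A0 /psi_term_eq0.
Qed.

Hypothesis t0 : t != 0.
Hypothesis yw_nopole : forall k, q / (y * w) * q ^+ k != 1.
Hypothesis yw1 : `|y * w| < 1.

(** As [`|q| ^+ J] is smaller than [`|y * w|] for some [J], the degrees from [J]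
    on have coefficient zero by [abs_summable4_degree]. *)
Lemma has_sum3_psi :
  abs_summable4 (fun n m k j =>
    rogers_weight q t s w n m k * psi_term a b x y q (n + m + k) j) ->
  exists2 S : K, has_sum (rogers_rhs_term a b x y q t s w) S &
    has_sum3
      (fun n m k => rogers_weight q t s w n m k * psi a b x y q (n + m + k))
      (rogers_prefactor y q t s w * S).
Proof.
move=> summable; have degree_lt := abs_summable4_degree summable.
have yw0 : 0 < `|y * w| by rewrite normr_gt0 mulf_neq0.
have [J _ ltJ] : \forall n \near \oo, `|0 - q ^+ n| < `|y * w|.
  by apply: cvgr_dist_lt => //; exact: cvg_abs_exp.
have A0 j : (J <= j)%N -> qpochs a q j / qpochs b q j * x ^+ j = 0.
  move=> /ltJ /=; rewrite sub0r normrN normrX => qj; apply/eqP.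
  by apply/negPn/negP => /degree_lt /(lt_trans qj); rewrite ltxx.
have rhs0 j : qpochs a q j / qpochs b q j * x ^+ j = 0 ->
    rogers_rhs_term a b x y q t s w j = 0.
  move=> Aj; rewrite /rogers_rhs_term.
  have -> : qpochs (q :: b) q j = qpoch q q j * qpochs b q j.
    by rewrite /qpochs big_cons.
  set P := Phi32 _ _ _ _ _ _ _.
  have -> : qpochs a q j / (qpoch q q j * qpochs b q j) * (x * t) ^+ j * P =
      qpochs a q j / qpochs b q j * x ^+ j * (t ^+ j / qpoch q q j * P).
    by rewrite invfM exprMn; ring.
  by rewrite Aj mul0r.
have degreeE j : has_sum3 (fun n m k =>
      rogers_weight q t s w n m k * psi_term a b x y q (n + m + k) j)
    (rogers_prefactor y q t s w * rogers_rhs_term a b x y q t s w j).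
  have [Aj|Aj] := eqVneq (qpochs a q j / qpochs b q j * x ^+ j) 0; last first.
    by apply: has_sum3_psi_term => //; exact: degree_lt.
  rewrite rhs0// mulr0.
  have sum0 : has_sum (fun=> 0 : K) 0.
    by have := @has_sum_finite K (fun=> 0) 0 (fun _ _ => erefl); rewrite big_ord0.
  have sum30 := has_sum3_prod sum0 sum0 sum0; rewrite !mul0r in sum30.
  apply: (has_sum3_ext sum30) => n m k.
  by rewrite psi_term_eq0// mulr0.
exists (\sum_(j < J) rogers_rhs_term a b x y q t s w j).
  by apply: has_sum_finite => j /A0 /rhs0.
rewrite mulr_sumr; apply: (has_sum3_ext (has_sum3_sum J degreeE)) => n m k.
by rewrite -mulr_sumr (psi_term_sum_finite _ A0).
Qed.

End Degrees.

Theorem theorem7 (R : realType) (r : nat)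
  (a : r.+1.-tuple R[i]) (b : r.-tuple R[i]) (q x y t s w : R[i])
  (q_neq0 : q != 0) (q_lt1 : `|q| < 1)
  (y_neq0 : y != 0) (t_neq0 : t != 0) (w_neq0 : w != 0)
  (b_nopole : forall (i : 'I_r) (k : nat), tnth b i * q ^+ k != 1)
  (yw_nopole : forall k : nat, q / (y * w) * q ^+ k != 1)
  (yw_lt1 : `|y * w| < 1) :
  (abs_summable4 (fun n m k j =>
       rogers_weight q t s w n m k * psi_term a b x y q (n + m + k) j) ->
     exists2 S : R[i],
       has_sum (rogers_rhs_term a b x y q t s w) S &
       has_sum3
         (fun n m k => rogers_weight q t s w n m k * psi a b x y q (n + m + k))
         (rogers_prefactor y q t s w * S))
  /\
  (forall j : nat, `|y * w| < `|q| ^+ j ->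
     has_sum3
       (fun n m k =>
          rogers_weight q t s w n m k * psi_term a b x y q (n + m + k) j)
       (rogers_prefactor y q t s w * rogers_rhs_term a b x y q t s w j)).
Proof.
have complete := @complex_abs_cvg_complete R.
split=> [summable|j ywj].
- exact: (has_sum3_psi complete).
- exact: (has_sum3_psi_term complete).
Qed.
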